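(* Let $q\ge 2$ and $n\ge 2$, and let $S=(s_i)$ be a negative orientable sequence of order $n$ over $\mathbb{Z}_q$. Then the period of $S$ is at most \[ \begin{cases} \bigl(q^n - q^{\lfloor n/2\rfloor} - q^{\lfloor (n-1)/2\rfloor} + 1\bigr)/2 & \text{if $q$ is odd},\\ \bigl(q^n - 2q^{(n-1)/2}\bigr)/2 - 1 & \text{if $q$ is even and $n$ is odd},\\ \bigl(q^n - q^{n/2}\bigr)/2 - 1 & \text{if $q$ is even and $n$ is even}. \end{cases} \]
   Context: Sequences are periodic with entries in $\mathbb{Z}_q$. For a sequence $S=(s_i)$ write $\mathbf{s}_n(i)=(s_i,s_{i+1},\ldots,s_{i+n-1})$. For an $n$-tuple $\mathbf{u}=(u_0,\ldots,u_{n-1})$, its reverse is $\mathbf{u}^R=(u_{n-1},\ldots,u_0)$ and its negative is $-\mathbf{u}=(-u_0,\ldots,-u_{n-1})$. A periodic sequence $S$ of period $m$ is an $n$-window sequence if $\mathbf{s}_n(i)=\mathbf{s}_n(j)$ implies $i\equiv j \pmod m$. An $n$-window sequence $S$ is a negative orientable sequence of order $n$ if $\mathbf{s}_n(i)\neq -\mathbf{s}_n(j)^R$ for all $i,j$. *)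

(* Defs.v *)
From HB Require Import structures.
From mathcomp Require Import all_boot all_order all_algebra.

Set Implicit Arguments.
Unset Strict Implicit.
Unset Printing Implicit Defensive.

Import GRing.Theory.
Local Open Scope ring_scope.

Definition window (T : Type) (s : nat -> T) (n i : nat) : n.-tuple T :=
  [tuple s (i + k)%N | k < n].

Definition reverse (T : Type) (n : nat) (u : n.-tuple T) : n.-tuple T :=
  [tuple of rev u].

Definition negative (V : zmodType) (n : nat) (u : n.-tuple V) : n.-tuple V :=
  [tuple of map (fun x => - x) u].

Definition periodic (T : Type) (s : nat -> T) (m : nat) : Prop :=
  (0 < m)%N /\ forall i : nat, s (i + m)%N = s i.

(* The implication forces m to be the least period of s: if p is any period,
   then window s n 0 = window s n p, so m divides p. *)
Definition window_sequence (T : Type) (n m : nat) (s : nat -> T) : Prop :=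
  periodic s m /\
  forall i j : nat, window s n i = window s n j -> (i = j %[mod m])%N.

Definition negative_orientable (V : zmodType) (n m : nat) (s : nat -> V) : Prop :=
  window_sequence n m s /\
  forall i j : nat, window s n i <> negative (reverse (window s n j)).

(* Main.v *)
(** Write [u' = -u^R]. The [n]-windows of [S] form a set [A] of [m] edges of the
    de Bruijn graph on the [(n-1)]-tuples, and [A], [A'] and the set [N] of
    tuples with [u = u'] are pairwise disjoint. This gives [2m + |N| <= q^n].
    For the refinement, let [v] be a vertex with [v = v']. The walk [S] enters
    [v] as often as it leaves it, and [u -> u'] exchanges incoming and outgoing
    edges at [v], so [A] and [A'] together contain an even number of the [q]
    edges leaving [v]. An edge of [N] leaves [v] only if [v] is constant, equal
    to [c] with [c = -c], and then only the edge [c...c] does. Hence an edge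
    outside [A], [A'] and [N] leaves [v] if either [q] is odd and [v <> 0], or
    [q] is even and [v] is such a constant. *)
Require Import Defs.
From HB Require Import structures.
From mathcomp Require Import all_boot all_order all_algebra.
From mathcomp Require Import zify lra.

Set Implicit Arguments.
Unset Strict Implicit.
Unset Printing Implicit Defensive.

Import Order.TTheory GRing.Theory Num.Theory.
Local Open Scope ring_scope.

(** * Negated reversal and the ends of an edge *)

Definition negrev (V : zmodType) (n : nat) (u : n.-tuple V) : n.-tuple V :=
  negative (reverse u).

(** An edge [u] of the de Bruijn graph runs from [tuple_init u] to [tuple_tail u]. *)
Definition tuple_init (V : zmodType) (p : nat) (u : p.+1.-tuple V) :
  p.-tuple V := [tuple nth 0 u i | i < p].

Definition tuple_tail (V : zmodType) (p : nat) (u : p.+1.-tuple V) :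
  p.-tuple V := [tuple nth 0 u i.+1 | i < p].

Definition negasymmetric (V : finZmodType) (n : nat) : {set n.-tuple V} :=
  [set u | negrev u == u].

Definition self_opposite (V : finZmodType) : {set V} := [set c | - c == c].

Lemma eq_tuple_nth (V : zmodType) (n : nat) (u v : n.-tuple V) :
  (forall i, (i < n)%N -> nth 0 u i = nth 0 v i) -> u = v.
Proof.
move=> uv; apply/val_inj/(@eq_from_nth _ 0); first by rewrite !size_tuple.
by move=> i; rewrite size_tuple; apply: uv.
Qed.

Lemma nth_mktuple_nat (V : zmodType) (n : nat) (f : nat -> V) i :
  (i < n)%N -> nth 0 [tuple f j | j < n] i = f i.
Proof. by move=> ltin; rewrite -[i in LHS]/(val (Ordinal ltin)) nth_mktuple. Qed.

Lemma nth_tuple_init (V : zmodType) (p : nat) (u : p.+1.-tuple V) i :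
  (i < p)%N -> nth 0 (tuple_init u) i = nth 0 u i.
Proof. exact: nth_mktuple_nat (fun i => nth 0 u i) _. Qed.

Lemma nth_tuple_tail (V : zmodType) (p : nat) (u : p.+1.-tuple V) i :
  (i < p)%N -> nth 0 (tuple_tail u) i = nth 0 u i.+1.
Proof. exact: nth_mktuple_nat (fun i => nth 0 u i.+1) _. Qed.

Lemma nth_window (V : zmodType) (s : nat -> V) (n i k : nat) :
  (k < n)%N -> nth 0 (window s n i) k = s (i + k)%N.
Proof. exact: nth_mktuple_nat (fun k => s (i + k)%N) _. Qed.

Lemma nth_negrev (V : zmodType) (n : nat) (u : n.-tuple V) i :
  (i < n)%N -> nth 0 (negrev u) i = - nth 0 u (n - i.+1)%N.
Proof.
move=> ltin; rewrite (nth_map 0) ?size_rev ?size_tuple//.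
by rewrite nth_rev ?size_tuple.
Qed.

Lemma negrevK (V : zmodType) (n : nat) : involutive (@negrev V n).
Proof.
move=> u; apply: eq_tuple_nth => i ltin.
rewrite !nth_negrev ?opprK; [|lia|lia].
by congr nth; lia.
Qed.

Lemma tuple_init_negrev (V : zmodType) (p : nat) (u : p.+1.-tuple V) :
  tuple_init (negrev u) = negrev (tuple_tail u).
Proof.
apply: eq_tuple_nth => i ltip.
rewrite nth_tuple_init// !nth_negrev// ?nth_tuple_tail; [|lia|lia].
by congr (- nth _ _ _); lia.
Qed.

Lemma negrev_nseq (V : zmodType) (n : nat) (c : V) :
  negrev [tuple of nseq n c] = [tuple of nseq n (- c)].
Proof.
apply: eq_tuple_nth => i ltin; rewrite nth_negrev// !nth_nseq ltin.
by rewrite ifT//; lia.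
Qed.

Lemma tuple_init_eq_tail (V : zmodType) (p : nat) (u : p.+1.-tuple V) :
  tuple_init u = tuple_tail u -> u = [tuple of nseq p.+1 (nth 0 u 0)].
Proof.
move=> itu; apply: eq_tuple_nth => i; rewrite nth_nseq => ltip.
rewrite ltip; elim: i ltip => // i IH ltip.
by rewrite -IH ?(ltnW ltip)// -nth_tuple_tail// -itu nth_tuple_init.
Qed.

Lemma tuple_init_nseq (V : zmodType) (p : nat) (c : V) :
  tuple_init [tuple of nseq p.+1 c] = [tuple of nseq p c].
Proof.
apply: eq_tuple_nth => i ltip; rewrite nth_tuple_init//.
by rewrite !nth_nseq ltip ifT//; lia.
Qed.

(* Here [tuple_tail u = negrev (tuple_init u) = tuple_init u]. *)
Lemma negasymmetric_init (V : finZmodType) (p : nat) (u : p.+1.-tuple V) :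
  u \in negasymmetric V p.+1 -> tuple_init u \in negasymmetric V p ->
  exists2 c, c \in self_opposite V & u = [tuple of nseq p.+1 c].
Proof.
rewrite !inE => /eqP nu /eqP niu.
have ti : tuple_init u = tuple_tail u.
  by rewrite -niu -{1}nu tuple_init_negrev negrevK.
exists (nth 0 u 0); last exact: tuple_init_eq_tail.
move: nu; rewrite (tuple_init_eq_tail ti) negrev_nseq inE.
by move=> /(congr1 (fun t : _.-tuple V => nth 0 t 0))/= ->.
Qed.

(** * Parity of the edges leaving a vertex fixed by [negrev] *)

Lemma card_fiber_tuple_init (V : finZmodType) (p : nat) (v : p.-tuple V) :
  #|[set u : p.+1.-tuple V | tuple_init u == v]| = #|V|.
Proof.
have initr x : tuple_init [tuple of rcons v x] = v.
  apply: eq_tuple_nth => i ltip; rewrite nth_tuple_init//= nth_rcons.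
  by rewrite size_tuple ltip.
rewrite -[RHS](@card_imset _ _ (fun x => [tuple of rcons v x])); last first.
  by move=> x y /(congr1 val)/= /rcons_inj[].
apply: eq_card => u; rewrite inE; apply/eqP/imsetP => [iu|[x _ ->]//].
exists (nth 0 u p) => //; apply: eq_tuple_nth => i ltip.
rewrite /= nth_rcons size_tuple; case: ltngtP => [lti|gti|->//].
  by rewrite -iu nth_tuple_init.
by lia.
Qed.

(** Vertices fixed by [negrev] from which an odd number of edges outside [negasymmetric] leave. *)
Definition odd_vertices (V : finZmodType) (p : nat) : {set p.-tuple V} :=
  [set v in negasymmetric V p | odd #|V| !=
     odd #|[set u in negasymmetric V p.+1 | tuple_init u == v]|].

(** A fixed tuple in [A] or in its image under [negrev] would lie in both. *)
Lemma disjoint_negasymmetric (V : finZmodType) (n : nat) (A : {set n.-tuple V}) :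
  [disjoint A & @negrev V n @: A] ->
  [disjoint A :|: @negrev V n @: A & negasymmetric V n].
Proof.
move=> disA; rewrite disjoint_sym disjoints_subset; apply/subsetP => u.
rewrite !inE => /eqP nu; apply/negP => uB.
have uA : u \in A.
  by case/orP: uB => // /imsetP[w wA uw]; rewrite -nu uw negrevK.
by move: (disjointFr disA uA); rewrite -{1}nu imset_f.
Qed.

(** Otherwise the [#|V|] edges leaving [v] would be the negasymmetric ones together with twice as
    many as leave [v] in [A], against the parity condition on [v]. *)
Lemma unused_edge (V : finZmodType) (p : nat) (A : {set p.+1.-tuple V}) v :
  (forall v, #|[set u in A | tuple_init u == v]| =
             #|[set u in A | tuple_tail u == v]|) ->
  [disjoint A & @negrev V p.+1 @: A] ->
  v \in odd_vertices V p ->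
  exists2 u, u \notin A :|: @negrev V p.+1 @: A :|: negasymmetric V p.+1
    & tuple_init u = v.
Proof.
move=> balA disA; rewrite inE => /andP[]; rewrite inE => /eqP nv.
set N := [set u in _ | _] => oddN.
set F := [set u : p.+1.-tuple V | tuple_init u == v].
set B := A :|: _.
have [u|noU] := pickP [pred u | (u \in F) && (u \notin B :|: negasymmetric V p.+1)].
  by rewrite /= inE => /andP[/eqP iu uB]; exists u.
have NB : [disjoint B & negasymmetric V p.+1].
  exact: disjoint_negasymmetric.
have FE : F = (F :&: B) :|: N.
  apply/setP => u; have /= := noU u; rewrite !inE.
  by case: (tuple_init u == v) => //=; rewrite ?andbF ?andbT//= => /negbFE ->.
have cardFB : #|F :&: B| = (#|F :&: A|).*2.
  rewrite setIUr cardsU -addnn.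
  have -> : (F :&: A) :&: (F :&: @negrev V p.+1 @: A) = set0.
    by rewrite setIACA (disjoint_setI0 disA) setI0.
  rewrite cards0 subn0; congr addn.
  have -> : F :&: A = [set u in A | tuple_init u == v].
    by apply/setP => u; rewrite !inE andbC.
  (* Balance replaces the edges of [A] leaving [v] by those entering it; since [v] is fixed,
     [negrev] maps the latter bijectively onto the edges of the image of [A] leaving [v]. *)
  rewrite balA -[RHS](card_imset _ (inv_inj (@negrevK V p.+1))).
  apply: eq_card => u; rewrite in_setI [u \in F]inE; apply/andP/imsetP.
    move=> [/eqP iu /imsetP[w wA uw]]; exists w => //.
    by rewrite inE wA -[tuple_tail w]negrevK -tuple_init_negrev -uw iu nv/=.
  move=> [w]; rewrite inE => /andP[wA /eqP tw] ->.
  by rewrite tuple_init_negrev tw nv imset_f.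
have disFB : (F :&: B) :&: N = set0.
  apply/setP => u; rewrite in_set0; apply/negP => /setIP[/setIP[_ uB]].
  by rewrite inE (disjointFr NB uB).
move: oddN; rewrite -(card_fiber_tuple_init v) -/F FE cardsU disFB cards0 subn0.
by rewrite cardFB oddD odd_double eqxx.
Qed.

Lemma card_orientable_le (V : finZmodType) (p : nat) (A : {set p.+1.-tuple V}) :
  (forall v, #|[set u in A | tuple_init u == v]| =
             #|[set u in A | tuple_tail u == v]|) ->
  [disjoint A & @negrev V p.+1 @: A] ->
  (#|A|.*2 + #|negasymmetric V p.+1| + #|odd_vertices V p| <= #|V| ^ p.+1)%N.
Proof.
move=> balA disA; set N := negasymmetric _ _; set D := odd_vertices V p.
set B := A :|: @negrev V p.+1 @: A.
have cardB : #|B| = #|A|.*2.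
  rewrite cardsU (disjoint_setI0 disA) cards0 subn0 -addnn; congr addn.
  by rewrite card_imset//; apply: inv_inj; apply: negrevK.
have BN : B :&: N = set0 by apply/disjoint_setI0/disjoint_negasymmetric.
have subD : D \subset @tuple_init V p @: ~: (B :|: N).
  apply/subsetP => v /(unused_edge balA disA)[u uU <-].
  by apply: imset_f; rewrite inE.
rewrite -card_tuple -(cardsC (B :|: N)) cardsU BN cards0 subn0 cardB leq_add2l.
exact: leq_trans (subset_leq_card subD) (leq_imset_card _ _).
Qed.

(** * Lower bounds for the number of odd vertices *)

Lemma odd_vertices_nseq (V : finZmodType) (p : nat) c :
  ~~ odd #|V| -> c \in self_opposite V ->
  [tuple of nseq p.+1 c] \in odd_vertices V p.+1.
Proof.
move=> evenV cV; have nc : - c = c by move: cV; rewrite inE => /eqP.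
have vN k : [tuple of nseq k c] \in negasymmetric V k by rewrite inE negrev_nseq nc.
rewrite inE vN (negbTE evenV)/=.
(* Exactly one negasymmetric edge leaves this vertex, while [#|V|] is even. *)
suff -> : [set u in negasymmetric V p.+2 | tuple_init u == [tuple of nseq p.+1 c]] =
          [set [tuple of nseq p.+2 c]] by rewrite cards1.
apply/setP => u; rewrite inE in_set1; apply/andP/eqP => [[uN /eqP iu]|->].
  have [|d _ ud] := negasymmetric_init uN; first by rewrite iu.
  move: iu; rewrite ud tuple_init_nseq => /(congr1 (fun t : _.-tuple V => nth 0 t 0)).
  by move=> /= ->.
by rewrite vN tuple_init_nseq.
Qed.

Lemma odd_vertices_neq0 (V : finZmodType) (p : nat) v :
  odd #|V| -> self_opposite V = [set 0] -> v \in negasymmetric V p ->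
  v != [tuple of nseq p 0] -> v \in odd_vertices V p.
Proof.
move=> oddV opp0 vN v0; rewrite inE vN oddV/=.
(* A negasymmetric edge leaving [v] would be constant with self-opposite value, hence zero, which
   would make [v] zero. *)
suff -> : [set u in negasymmetric V p.+1 | tuple_init u == v] = set0 by rewrite cards0.
apply/setP => u; rewrite in_set0 inE; apply/negP => /andP[uN /eqP iu].
have [|c] := negasymmetric_init uN; first by rewrite iu.
rewrite opp0 inE => /eqP -> uc.
by move: v0; rewrite -iu uc tuple_init_nseq eqxx.
Qed.

Lemma card_odd_vertices_even (V : finZmodType) (p : nat) :
  ~~ odd #|V| -> (#|self_opposite V| <= #|odd_vertices V p.+1|)%N.
Proof.
move=> evenV.
rewrite -(@card_imset _ _ (fun c => [tuple of nseq p.+1 c])); last first.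
  by move=> c d /(congr1 (fun t : _.-tuple V => nth 0 t 0)).
apply/subset_leq_card/subsetP => _ /imsetP[c cV ->].
exact: odd_vertices_nseq.
Qed.

Lemma card_odd_vertices_odd (V : finZmodType) (p : nat) :
  odd #|V| -> self_opposite V = [set 0] ->
  (#|negasymmetric V p| <= #|odd_vertices V p|.+1)%N.
Proof.
move=> oddV opp0; rewrite (cardsD1 [tuple of nseq p 0]) -add1n leq_add ?leq_b1//.
apply/subset_leq_card/subsetP => v /setD1P[v0 vN].
exact: odd_vertices_neq0.
Qed.

(** * Lower bound for the number of negasymmetric tuples *)

Lemma negrev_cons_rcons (V : zmodType) (n : nat) (u : n.-tuple V) (x : V) :
  negrev [tuple of x :: rcons u (- x)] = [tuple of x :: rcons (negrev u) (- x)].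
Proof.
by apply: val_inj; rewrite /= rev_cons rev_rcons map_rcons /= opprK.
Qed.

(** Induction in steps of two: putting [x] before and [- x] after a negasymmetric tuple gives
    another one. In odd length the middle entry is self-opposite. *)
Lemma card_negasymmetric_ge (V : finZmodType) (n : nat) :
  (#|self_opposite V| ^ odd n * #|V| ^ n./2 <= #|negasymmetric V n|)%N.
Proof.
elim/ltn_ind: n => -[|[|n]] IH.
- rewrite expn0 mul1n expn0 card_gt0; apply/set0Pn; exists [tuple].
  by rewrite inE [negrev _]tuple0.
- rewrite expn1 expn0 muln1.
  rewrite -(@card_imset _ _ (fun c => [tuple of nseq 1 c])); last first.
    by move=> c d /(congr1 (fun t : _.-tuple V => nth 0 t 0)).
  apply/subset_leq_card/subsetP => _ /imsetP[c cV ->].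
  by move: cV; rewrite !inE negrev_nseq => /eqP ->.
have {}IH := IH n (ltnW (ltnSn _)).
rewrite /= negbK expnS mulnCA.
apply: leq_trans (leq_mul (leqnn #|V|) IH) _.
rewrite -cardsT -cardsX.
pose f (xu : V * n.-tuple V) := [tuple of xu.1 :: rcons xu.2 (- xu.1)].
rewrite -(@card_imset _ _ f); last first.
  by move=> [x u] [y w] /(congr1 val)/= -[-> /rcons_inj[/val_inj ->]].
apply/subset_leq_card/subsetP => _ /imsetP[[x u] xuN ->].
move: xuN; rewrite !inE/= => /eqP nu.
by rewrite /f negrev_cons_rcons nu.
Qed.

(** * The windows of a sequence as a closed walk *)

Lemma tuple_init_window (V : zmodType) (s : nat -> V) (p i : nat) :
  tuple_init (window s p.+1 i) = window s p i.
Proof.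
by apply: eq_tuple_nth => k ltkp; rewrite nth_tuple_init// !nth_window// ltnW.
Qed.

Lemma tuple_tail_window (V : zmodType) (s : nat -> V) (p i : nat) :
  tuple_tail (window s p.+1 i) = window s p i.+1.
Proof.
apply: eq_tuple_nth => k ltkp; rewrite nth_tuple_tail// !nth_window//.
by rewrite addnS addSn.
Qed.

Lemma periodic_modn (T : Type) (s : nat -> T) (m i : nat) :
  periodic s m -> s (i %% m)%N = s i.
Proof.
move=> [_ per]; rewrite [in RHS](divn_eq i m) addnC.
by elim: (i %/ m)%N => [|k IH]; rewrite ?addn0// mulSn addnCA addnC per.
Qed.

Lemma window_modn (V : zmodType) (s : nat -> V) (n m i : nat) :
  periodic s m -> window s n (i %% m) = window s n i.
Proof.
move=> per; apply: eq_tuple_nth => k ltkn; rewrite !nth_window//.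
by rewrite -[LHS](periodic_modn _ per) modnDml periodic_modn.
Qed.

Lemma negative_orientable_card_le (V : finZmodType) (p m : nat) (s : nat -> V) :
  negative_orientable p.+1 m s ->
  (m.*2 + #|negasymmetric V p.+1| + #|odd_vertices V p| <= #|V| ^ p.+1)%N.
Proof.
move=> [[per inj] ori].
pose W (i : 'I_m) := window s p.+1 i.
have injW : injective W.
  by move=> i j /inj; rewrite !modn_small// => /val_inj.
have cardW (P : pred _) : #|[set u in W @: setT | P u]| = #|[set i | P (W i)]|.
  rewrite -(card_imset _ injW); apply: eq_card => u; rewrite inE.
  apply/andP/imsetP => [[/imsetP[i _ ->] Pi]|[i]].
    by exists i; rewrite ?inE.
  by rewrite inE => Pi ->; rewrite imset_f.
have := @card_orientable_le V p (W @: setT).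
rewrite card_imset// cardsT card_ord; apply.
  (* The vertex entered by window [i] is left by the next window, and the cyclic successor [ordS]
     permutes the indices. *)
  move=> v; rewrite !cardW -(card_preimset _ (@ordS_inj m)).
  apply: eq_card => i; rewrite !inE tuple_init_window tuple_tail_window.
  by rewrite /= window_modn.
rewrite disjoints_subset; apply/subsetP => _ /imsetP[i _ ->]; rewrite inE.
by apply/negP => /imsetP[_ /imsetP[j _ ->]]; apply: ori.
Qed.

(** * Self-opposite residues and the final count *)

Lemma self_opposite_Zp_odd (q : nat) :
  (1 < q)%N -> odd q -> self_opposite 'Z_q = [set 0].
Proof.
move=> q1 oddq; apply/setP => c; rewrite !inE; apply/eqP/eqP => [nc|->]; last first.
  by rewrite oppr0.
have c2 : c *+ 2 = 0 by rewrite mulr2n -{1}nc addNr.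
(* As [q] is odd, [c *+ 2 = 0] and [c *+ q = 0] together force [c = 0]. *)
have qE : q = (1 + 2 * q./2)%N by lia.
have : c *+ q = 0 by rewrite -mulr_natr pchar_Zp// mulr0.
by rewrite [X in c *+ X]qE mulrnDr mulrnA c2 mul0rn addr0.
Qed.

(** The residues [0] and [q / 2] are distinct and self-opposite. *)
Lemma card_self_opposite_Zp_even (q : nat) :
  (1 < q)%N -> ~~ odd q -> (2 <= #|self_opposite 'Z_q|)%N.
Proof.
move=> q1 evenq; pose h : 'Z_q := (q./2)%:R.
have h0 : h != 0.
  rewrite -(inj_eq val_inj)/= val_Zp_nat// modn_small; lia.
have hh : - h = h.
  apply/eqP; rewrite eq_sym -addr_eq0 -natrD addnn.
  have -> : (q./2).*2 = q by lia.
  by rewrite pchar_Zp.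
have /subset_leq_card : [set 0; h] \subset self_opposite 'Z_q.
  by apply/subsetP => x; rewrite !inE => /orP[]/eqP ->; rewrite ?oppr0 ?hh.
by rewrite cards2 eq_sym h0.
Qed.

Theorem theorem1 (q n m : nat) (hq : (2 <= q)%N) (hn : (2 <= n)%N)
    (s : nat -> 'Z_q) (hs : negative_orientable n m s) :
  (m%:R : rat) <=
    (if odd q then
       (q%:R ^+ n - q%:R ^+ (n %/ 2) - q%:R ^+ ((n - 1) %/ 2) + 1) / 2
     else if odd n then
       (q%:R ^+ n - 2 * q%:R ^+ ((n - 1) %/ 2)) / 2 - 1
     else
       (q%:R ^+ n - q%:R ^+ (n %/ 2)) / 2 - 1).
Proof.
(* With [n = p.+2] the vertices have positive length [p.+1], so distinct constants give distinct
   vertices. *)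
case: n hn hs => [|[|p]]// _ hs; rewrite !divn2 subn1 -[p.+2.-1]/p.+1.
have cardV : #|'Z_q| = q by rewrite card_ord Zp_cast.
have := @negative_orientable_card_le 'Z_q p.+1 m s hs.
have := card_negasymmetric_ge 'Z_q p.+2.
rewrite cardV; case: ifPn => [oddq|evenq].
  have opp0 := self_opposite_Zp_odd hq oddq.
  have := @card_odd_vertices_odd 'Z_q p.+1; rewrite cardV => /(_ oddq opp0).
  have := card_negasymmetric_ge 'Z_q p.+1.
  rewrite opp0 cards1 !exp1n !mul1n cardV => N1 D1 N2 bound.
  (* The [+ 1] accounts for the zero vertex, which is not counted among the odd ones. *)
  have : (m.*2 + q ^ (p.+2)./2 + q ^ (p.+1)./2 <= q ^ p.+2 + 1)%N by lia.
  rewrite -(ler_nat rat) -addnn !natrD !natrX; lra.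
have := @card_odd_vertices_even 'Z_q p; rewrite cardV => /(_ evenq).
have := card_self_opposite_Zp_even hq evenq.
set t := #|self_opposite _| => t2 D N bound.
case: ifPn N => [oddn|evenn]; rewrite ?expn1 ?expn0 ?mul1n => N.
  (* For odd [n] the bound [2 <= t] is used twice: as the factor from the middle entry of a
     negasymmetric tuple, and for two odd vertices, which give the [- 1] after halving. *)
  have h : (p.+2)./2 = (p.+1)./2 by lia.
  have : (m.*2 + (q ^ (p.+1)./2).*2 + 2 <= q ^ p.+2)%N.
    rewrite h in N.
    have := leq_mul t2 (leqnn (q ^ (p.+1)./2)); lia.
  rewrite -(ler_nat rat) -!addnn !natrD !natrX; lra.
have : (m.*2 + q ^ (p.+2)./2 + 2 <= q ^ p.+2)%N by lia.
rewrite -(ler_nat rat) -addnn !natrD !natrX; lra.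
Qed.
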